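(* Let $g$ and $\kappa$ be non-negative integers. The map $\phi: \mathcal{G}_\kappa(g) \to \mathcal{C}_{\kappa+1}(g+1)$ is well defined (that is, $\phi(G) \in \mathcal{C}_{\kappa+1}(g+1)$ for every $G \in \mathcal{G}_\kappa(g)$) and it is injective. Moreover, if $G \in \mathcal{G}_\kappa(g)$ has multiplicity $m$, then: (1) if $q(G) = 1$, then $\phi(G)$ is a gapset of depth $2$; (2) if $q(G) = 2$, then $\phi(G)$ is an $(m+1)$-set of depth $2$; (3) if $q(G) = 3$, then $\phi(G)$ is an $(m+1)$-set of depth $3$, except for the case in which $2m+1 \in G$ and $\ell_\alpha \geq 2m+1$.
   Context: $\mathbb{N}$ denotes the positive integers and $[a,b]$ the set of integers $x$ with $a \le x \le b$. A gapset is a finite set $G \subset \mathbb{N}$ such that whenever $z \in G$ and $z = x+y$ with $x,y \in \mathbb{N}$, then $x \in G$ or $y \in G$. The genus of $G$ is its cardinality $g$; we write $G = \{\ell_1 < \ell_2 < \cdots < \ell_g\}$. The multiplicity is $m(G) := \min\{s \in \mathbb{N} : s \notin G\}$; the conductor $c(G)$ is the least $s$ such that $s+n \notin G$ for all integers $n \geq 0$ (so $c(G) = \ell_g+1$ for $G \ne \emptyset$, and $c(\emptyset)=0$); the depth is $q(G) := \lceil c(G)/m(G) \rceil$. For $g \geq 2$, $G$ is pure $\kappa$-sparse if $\ell_{i+1}-\ell_i \leq \kappa$ for all $i \in [1,g-1]$ and $\ell_{i+1}-\ell_i = \kappa$ for some $i$. By convention, $\emptyset$ is pure $0$-sparse and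 $\{1\}$ is pure $1$-sparse (and for no other value of the parameter). $\mathcal{G}_\kappa(g)$ denotes the set of all pure $\kappa$-sparse gapsets of genus $g$. $\mathcal{C}_\kappa(g)$ denotes the set of all subsets of $[1,2g-1]$ having exactly $g$ elements and such that the maximum distance between two consecutive elements (in the natural order) is $\kappa$ (with the convention that this maximum distance is $1$ for the set $\{1\}$). For an integer $m > 2$, an $m$-set is a finite set $M \subset \mathbb{N}$ such that $[1,m-1] \subset M$ and $M$ contains no multiple of $m$. The depth of an $m$-set $M$ with largest element $c$ is $\lceil c/m \rceil$. The map $\phi$: for $G = \{\ell_1 < \cdots < \ell_g\} \in \mathcal{G}_\kappa(g)$ with $g \geq 2$, let $\alpha := \max\{i : \ell_{i+1}-\ell_i = \kappa\}$ and $$\phi(G) := \{1\} \cup \{\ell_i + 1 : 1 \leq i \leq \alpha\} \cup \{\ell_i + 2 : \alpha+1 \leq i \leq g\}.$$ By convention $\phi(\emptyset) = \{1\}$ and $\phi(\{1\}) = \{1,3\}$. *)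

(* Defs.v *)
From HB Require Import structures.
From mathcomp Require Import all_boot.
From mathcomp Require Import finmap.
From mathcomp Require Import boolp classical_sets functions.

Set Implicit Arguments.
Unset Strict Implicit.
Unset Printing Implicit Defensive.

Local Open Scope fset_scope.
Local Open Scope nat_scope.

(* Finite sets of positive integers are represented by [{fset nat}], and
   positivity is imposed by requiring that 0 is not a member. *)

Definition is_gapset (G : {fset nat}) : Prop :=
  0 \notin G /\
  forall x y, 0 < x -> 0 < y -> x + y \in G -> x \in G \/ y \in G.

(* [ell G i] is the i-th smallest element of G, numbered from 1; it is junk
   (equal to 0) for i > #|` G|. *)
Definition ell (G : {fset nat}) (i : nat) : nat :=
  nth 0 (sort leq (enum_fset G)) i.-1.

(* The truncated subtraction is exact for 1 <= i < #|` G|. *)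
Definition gap (G : {fset nat}) (i : nat) : nat := ell G i.+1 - ell G i.

Lemma fset_nat_bounded (G : {fset nat}) :
  exists b, forall n, b <= n -> n \notin G.
Proof.
exists (\max_(x <- enum_fset G) x).+1 => n; apply: contraL => nG.
by rewrite -leqNgt; exact: (@leq_bigmax_seq _ _ xpredT id).
Qed.

Lemma ex_multiplicity (G : {fset nat}) : exists s, (0 < s) && (s \notin G).
Proof.
have [b bP] := fset_nat_bounded G.
by exists b.+1; rewrite /= bP.
Qed.

Lemma ex_conductor (G : {fset nat}) :
  exists s, `[< forall n, s + n \notin G >].
Proof.
have [b bP] := fset_nat_bounded G.
by exists b; apply/asboolP => n; apply: bP; rewrite leq_addr.
Qed.

Definition multiplicity (G : {fset nat}) : nat := ex_minn (ex_multiplicity G).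

Definition conductor (G : {fset nat}) : nat := ex_minn (ex_conductor G).

Definition ceil_div (a b : nat) : nat := (a + b.-1) %/ b.

Lemma leq_ceil_div a b k : 0 < b -> (ceil_div a b <= k) = (a <= k * b).
Proof.
case: b => // b _; rewrite /ceil_div /= -ltnS ltn_divLR // mulSn.
by rewrite addSn ltnS addnC leq_add2l.
Qed.

Definition depth (G : {fset nat}) : nat :=
  ceil_div (conductor G) (multiplicity G).

Definition pure_sparse (kappa : nat) (G : {fset nat}) : Prop :=
  [\/ G = fset0 /\ kappa = 0,
      G = [fset 1] /\ kappa = 1
    | [/\ 2 <= #|` G|,
          forall i, 1 <= i < #|` G| -> gap G i <= kappa
        & exists2 i, 1 <= i < #|` G| & gap G i = kappa] ].

Definition Gk (kappa g : nat) : set {fset nat} :=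
  [set G | [/\ is_gapset G, #|` G| = g & pure_sparse kappa G] ]%classic.

Definition max_distance (A : {fset nat}) : nat :=
  if A == [fset 1] then 1 else \max_(1 <= i < #|` A|) gap A i.

Definition Ck (kappa g : nat) : set {fset nat} :=
  [set A | [/\ forall x, x \in A -> 1 <= x <= 2 * g - 1,
               #|` A| = g & max_distance A = kappa] ]%classic.

Definition is_mset (m : nat) (M : {fset nat}) : Prop :=
  [/\ 2 < m, 0 \notin M, forall x, 1 <= x <= m - 1 -> x \in M
    & forall x, x \in M -> ~~ (m %| x)].

Definition mset_depth (m : nat) (M : {fset nat}) : nat :=
  ceil_div (\max_(x <- enum_fset M) x) m.

Definition alpha (kappa : nat) (G : {fset nat}) : nat :=
  \max_(1 <= i < #|` G| | gap G i == kappa) i.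

Definition phi (kappa : nat) (G : {fset nat}) : {fset nat} :=
  if G == fset0 then [fset 1]
  else if G == [fset 1] then [fset 1; 3]
  else [fset 1]
    `|` [fset ell G i + 1 | i in index_iota 1 (alpha kappa G).+1]
    `|` [fset ell G i + 2 | i in index_iota (alpha kappa G).+1 #|` G|.+1].

(* Main.v *)
(* With x_i the i-th element of G, the increasing enumeration of phi(G) is 1
   followed by the x_i + 1 + (alpha < i).  So every gap of G is kept except the
   last gap kappa, which becomes the only gap kappa + 1; this locates alpha in
   the image and gives injectivity, while l_g <= 2g - 1 bounds the largest
   element.  In depth at least 2, the gap just after m - 1 exceeds 1, so
   l_alpha >= m - 1: thus [1, m] lies in phi(G) and m + 1 does not.  As G
   contains no multiple of m, in depth 3 the only multiple of m + 1 that can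
   occur is 2m + 2, as the image of 2m + 1 when l_alpha >= 2m + 1. *)

Require Import Defs.
From mathcomp Require Import all_boot.
From mathcomp Require Import finmap.
From mathcomp Require Import boolp classical_sets functions.
From mathcomp Require Import zify.

(** * The increasing enumeration of a finite set *)

Lemma size_sort_enum (G : {fset nat}) : size (sort leq (enum_fset G)) = #|` G|.
Proof. by rewrite size_sort. Qed.

Lemma ell_in (G : {fset nat}) i : 0 < i <= #|` G| -> ell G i \in G.
Proof.
move=> i_bnd; have: ell G i \in sort leq (enum_fset G).
  by apply: mem_nth; rewrite size_sort_enum; lia.
by rewrite mem_sort.
Qed.

Lemma ltn_ell (G : {fset nat}) i j :
  0 < i -> i < j -> j <= #|` G| -> ell G i < ell G j.
Proof.
move=> i_gt0 lt_ij le_jG.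
have srt : sorted ltn (sort leq (enum_fset G)).
  by rewrite ltn_sorted_uniq_leq sort_uniq fset_uniq (sort_sorted leq_total).
by apply: (sorted_ltn_nth ltn_trans 0 srt);
  rewrite ?inE ?size_sort_enum; lia.
Qed.

Lemma leq_ell (G : {fset nat}) i j :
  0 < i -> i <= j -> j <= #|` G| -> ell G i <= ell G j.
Proof.
move=> i_gt0; rewrite leq_eqVlt => /predU1P[-> //|lt_ij] le_jG.
exact/ltnW/ltn_ell.
Qed.

Lemma in_ell (G : {fset nat}) (x : nat) :
  x \in G -> exists2 i, 0 < i <= #|` G| & x = ell G i.
Proof.
move=> xG; have xs : x \in sort leq (enum_fset G) by rewrite mem_sort.
exists (index x (sort leq (enum_fset G))).+1; last by rewrite /ell nth_index.
by rewrite /= -size_sort_enum index_mem.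
Qed.

Lemma ellS_le (G : {fset nat}) i (x : nat) : x \in G -> 0 < i <= #|` G| ->
  ell G i < x -> ell G i.+1 <= x.
Proof.
move=> /in_ell[j j_bnd ->] i_bnd lt_ij.
have [le_ji|lt_i] := leqP j i; last by apply: leq_ell; lia.
by have := @leq_ell G j i; lia.
Qed.

(** Two strictly increasing lists with the same members coincide. This turns a guessed formula [f]
    for the elements of a set into both its cardinality and its enumeration. *)
Lemma ell_unique (A : {fset nat}) n (f : nat -> nat) :
  (forall i j, 0 < i -> i < j -> j <= n -> f i < f j) ->
  (forall x, x \in A <-> exists2 i, 0 < i <= n & x = f i) ->
  #|` A| = n /\ forall i, 0 < i <= n -> ell A i = f i.
Proof.
move=> f_mono A_def.
have sortE : sort leq (enum_fset A) = [seq f i | i <- iota 1 n].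
  apply: (irr_sorted_eq ltn_trans ltnn).
  - by rewrite ltn_sorted_uniq_leq sort_uniq fset_uniq (sort_sorted leq_total).
  - apply: (@homo_sorted_in _ _ (fun i => 0 < i <= n) f ltn ltn).
    + by move=> i j /andP[? _] /andP[_ ?] ?; apply: f_mono.
    + by apply/allP => i; rewrite mem_iota /=; lia.
    + exact: iota_ltn_sorted.
  - move=> x; rewrite mem_sort; apply/idP/mapP.
    + by move=> /A_def[i i_bnd ->]; exists i; rewrite // mem_iota; lia.
    + move=> [i i_bnd ->]; apply/A_def; exists i => //.
      by move: i_bnd; rewrite mem_iota; lia.
split=> [|i i_bnd]; first by rewrite -size_sort_enum sortE size_map size_iota.
rewrite /ell sortE (nth_map 0) ?size_iota; last by lia.
by rewrite nth_iota; [congr f; lia | lia].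
Qed.

Lemma ell_inj (G H : {fset nat}) : #|` G| = #|` H| ->
  (forall i, 0 < i <= #|` G| -> ell G i = ell H i) -> G = H.
Proof.
move=> eq_card eq_ell; apply/fsetP => x; apply/idP/idP.
  by move=> /in_ell[i i_bnd ->]; rewrite eq_ell // ell_in // -eq_card.
move=> /in_ell[i i_bnd ->].
by rewrite -eq_ell ?eq_card // ell_in // eq_card.
Qed.

(** * Multiplicity, conductor and depth *)

Lemma multiplicityP (G : {fset nat}) :
  [/\ 0 < multiplicity G, multiplicity G \notin G
    & forall x, 0 < x < multiplicity G -> x \in G].
Proof.
rewrite /multiplicity; case: ex_minnP => m /andP[m_gt0 mG] m_min.
split=> // x /andP[x_gt0 lt_xm]; apply: contraLR lt_xm => xG.
by rewrite -leqNgt m_min // x_gt0.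
Qed.

Lemma multiplicity_unique (G : {fset nat}) m : 0 < m -> m \notin G ->
  (forall x, 0 < x < m -> x \in G) -> multiplicity G = m.
Proof.
move=> m_gt0 mG lt_mG; have [mul_gt0 mulG lt_mulG] := multiplicityP G.
have [lt_m|lt_m|//] := ltngtP (multiplicity G) m.
  by move: mulG; rewrite lt_mG ?mul_gt0.
by move: mG; rewrite lt_mulG ?m_gt0.
Qed.

Lemma conductor_max (G : {fset nat}) (x : nat) : x \in G ->
  (forall y, y \in G -> y <= x) -> conductor G = x.+1.
Proof.
move=> xG x_max; rewrite /conductor; case: ex_minnP => c /asboolP c_out c_min.
apply/eqP; rewrite eqn_leq c_min /=; last first.
  by apply/asboolP => n; apply/negP => /x_max; lia.
rewrite ltnNge; apply/negP => /subnKC eq_x.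
by have := c_out (x - c); rewrite eq_x xG.
Qed.

Lemma conductor_ell (G : {fset nat}) :
  0 < #|` G| -> conductor G = (ell G #|` G|).+1.
Proof.
move=> g_gt0; apply: conductor_max => [|y /in_ell[i i_bnd ->]].
  by apply: ell_in; lia.
by apply: leq_ell; lia.
Qed.

Lemma ceil_div_eqS a b k :
  0 < b -> ceil_div a b = k.+1 <-> k * b < a <= k.+1 * b.
Proof.
move=> b_gt0; have := leq_ceil_div a k b_gt0.
have := leq_ceil_div a k.+1 b_gt0; lia.
Qed.

(** * Elements of gapsets: multiples and the upper bound *)

(** By induction on the quotient: splitting (k + 1)m as m + km would put m or km in G. *)
Lemma gapset_dvd (G : {fset nat}) m x :
  is_gapset G -> m \notin G -> m %| x -> x \notin G.
Proof.
move=> [G0 GD] mG /dvdnP[k ->]; elim: k => [//|k IHk].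
have [-> |m_gt0] := posnP m; first by rewrite muln0.
have [-> |k_gt0] := posnP k; first by rewrite mul1n.
rewrite mulSn; apply/negP => /GD [||mG'|kG] //; first by rewrite muln_gt0 k_gt0.
- by rewrite mG' in mG.
- by rewrite kG in IHk.
Qed.

(** Every number is a multiple of 1, so multiplicity 1 would leave G empty. *)
Lemma gapset_multiplicity_gt1 (G : {fset nat}) :
  is_gapset G -> 0 < #|` G| -> 1 < multiplicity G.
Proof.
move=> gapG G_gt0; have [m_gt0 mG _] := multiplicityP G.
rewrite ltn_neqAle m_gt0 andbT; apply/eqP => m1.
have := ell_in G 1 G_gt0; apply/negP.
by apply: gapset_dvd gapG mG _; rewrite -m1.
Qed.

(* One summand of every decomposition x = y + (x - y) lies in G, so the
   elements of G below x and their reflections cover [1, x - 1]. *)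
Lemma gapset_leq (G : {fset nat}) (x : nat) :
  is_gapset G -> x \in G -> x <= 2 * #|` G| - 1.
Proof.
(* Removing x leaves g - 1 elements, so the covering gives x - 1 <= 2(g - 1). *)
move=> [G0 GD] xG; set s := rem x (enum_fset G).
have sP y : y \in G -> y != x -> y \in s.
  by move=> yG yx; rewrite mem_rem_uniq ?fset_uniq // inE yx.
have : size (iota 1 x.-1) <= size (s ++ [seq x - y | y <- s]).
  apply: uniq_leq_size; first exact: iota_uniq.
  move=> y; rewrite mem_iota mem_cat => y_bnd.
  have : y + (x - y) \in G by rewrite subnKC //; lia.
  case/GD => [||yG|yG]; [lia|lia| |].
    by rewrite sP //; lia.
  apply/orP; right; apply/mapP; exists (x - y); last by lia.
  by apply: sP => //; lia.
have -> : size (s ++ [seq x - y | y <- s]) = #|` G|.-1 + #|` G|.-1.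
  by rewrite size_cat size_map size_rem.
rewrite size_iota.
have : 0 < #|` G| by rewrite cardfs_gt0; apply/fset0Pn; exists x.
have : 0 < x by rewrite lt0n; apply: contraNneq G0 => <-.
lia.
Qed.

Lemma in_imfset_index_iota (h : nat -> nat) m n (x : nat) :
  x \in [fset h i | i in index_iota m n]%fset <->
  exists2 i : nat, m <= i < n & x = h i.
Proof.
split=> [/imfsetP[i /= i_in ->]|[i i_bnd ->]].
  by exists i; rewrite // -mem_index_iota.
by apply/imfsetP; exists i; rewrite // mem_index_iota.
Qed.

(** * The image of a gapset of genus at least 2 *)

Section Phi.

Variables (kappa : nat) (G : {fset nat}).
Hypotheses (G_ge2 : 1 < #|` G|) (gapG : is_gapset G).
Hypothesis gap_le : forall i, 1 <= i < #|` G| -> gap G i <= kappa.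
Hypothesis gap_eq : exists2 i, 1 <= i < #|` G| & gap G i = kappa.

Let a := alpha kappa G.

Lemma alphaP : [/\ 0 < a < #|` G|, gap G a = kappa
  & forall i, a < i < #|` G| -> gap G i < kappa].
Proof.
have a_max i : 0 < i < #|` G| -> gap G i = kappa -> i <= a.
  move=> i_bnd /eqP gap_i; rewrite /a /alpha.
  by apply: (@leq_bigmax_seq _ _ _ id) => //; rewrite mem_index_iota.
(* A maximum over a filtered range is either the default 0 or attained; [gap_eq] then rules out
   0. *)
have : a = 0 \/ (0 < a < #|` G|) && (gap G a == kappa).
  rewrite /a /alpha big_seq_cond.
  elim/big_ind: _ => [|x y Hx Hy|i]; first by left.
  - by rewrite /maxn; case: ifP.
  - by rewrite mem_index_iota => ?; right.
case=> [a0|/andP[a_bnd /eqP gap_a]].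
  by case: gap_eq => i i_bnd /(a_max i i_bnd); lia.
split=> // i i_bnd; have := gap_le i; have := a_max i; lia.
Qed.

Let f i := if i <= 1 then 1 else ell G i.-1 + 1 + (a < i.-1).

Lemma phi_in (x : nat) : x \in phi kappa G <->
  x = 1 \/ exists2 i, 0 < i <= #|` G| & x = ell G i + 1 + (a < i).
Proof.
have [a_bnd _ _] := alphaP.
rewrite /phi; case: eqP => [G0|_]; first by move: G_ge2; rewrite G0 cardfs0.
case: eqP => [G1|_]; first by move: G_ge2; rewrite G1 cardfs1.
rewrite !inE -/a; split.
  case/orP => [/orP[/eqP|]|]; first by left.
    by move=> /in_imfset_index_iota[i i_bnd ->]; right; exists i; lia.
  by move=> /in_imfset_index_iota[i i_bnd ->]; right; exists i; lia.
case=> [->|[i i_bnd ->]]; first by rewrite eqxx.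
case: (ltnP a i) => [lt_ai|le_ia] /=.
  apply/orP; right; apply/in_imfset_index_iota; exists i; last by lia.
  by rewrite lt_ai; case/andP: i_bnd.
apply/orP; left; apply/orP; right.
by apply/in_imfset_index_iota; exists i; lia.
Qed.

Lemma ell1_gapset : ell G 1 = 1.
Proof.
have [_ _ ltG] := multiplicityP G.
have := gapset_multiplicity_gt1 G gapG (ltnW G_ge2) => m_gt1.
have : 1 \in G by apply: ltG.
case/in_ell=> i i_bnd e1.
have := @leq_ell G 1 i; have := ell_in G 1 (ltnW G_ge2).
case: gapG => G0 _.
have [-> G0'|] := posnP (ell G 1); first by rewrite G0' in G0.
lia.
Qed.

Lemma phi_ell : #|` phi kappa G| = #|` G|.+1 /\
  forall i, 0 < i <= #|` G|.+1 -> ell (phi kappa G) i = f i.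
Proof.
apply: ell_unique => [i j i_gt0 lt_ij le_j|x].
  (* The new element 1 stays below the rest because l_1 = 1 is moved to at least 2. *)
  rewrite /f; have [le_i|lt_i] := leqP i 1.
    have := @leq_ell G 1 j.-1; rewrite ell1_gapset ifN; lia.
  by have := @ltn_ell G i.-1 j.-1; rewrite ifN; lia.
rewrite phi_in /f; split.
  case=> [->|[i i_bnd ->]]; first by exists 1.
  by exists i.+1; [lia | rewrite ifN; [|lia]].
case=> i i_bnd ->; case: (leqP i 1) => i1; first by left.
by right; exists i.-1 => //; lia.
Qed.

Lemma phi_ellS i : 0 < i <= #|` G| ->
  ell (phi kappa G) i.+1 = ell G i + 1 + (a < i).
Proof. by move=> i_bnd; rewrite phi_ell.2 ?/f ?ifN //; lia. Qed.

Lemma phi_gapS i : 0 < i < #|` G| ->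
  gap (phi kappa G) i.+1 = gap G i + (i == a).
Proof.
move=> i_bnd; rewrite /gap !phi_ellS; [|lia|lia].
have := @ltn_ell G i i.+1; lia.
Qed.

Lemma phi_gap1 : gap (phi kappa G) 1 = 1.
Proof.
have [a_bnd _ _] := alphaP.
rewrite /gap phi_ellS ?ell1_gapset; last by lia.
by rewrite phi_ell.2 // /f /=; lia.
Qed.

Lemma phi_maximal (x : nat) : x \in phi kappa G -> x <= ell G #|` G| + 2.
Proof.
case/phi_in => [->|[i i_bnd ->]]; first by lia.
by have := @leq_ell G i #|` G|; lia.
Qed.

(** Since alpha < g, the last element of G is always among those shifted by 2. *)
Lemma phi_last : ell G #|` G| + 2 \in phi kappa G.
Proof.
have [a_bnd _ _] := alphaP.
by apply/phi_in; right; exists #|` G|; lia.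
Qed.

Lemma phi_bigmax : \max_(x <- enum_fset (phi kappa G)) x = ell G #|` G| + 2.
Proof.
apply/eqP; rewrite eqn_leq; apply/andP; split.
  by apply/bigmax_leqP_seq => x xphi _; apply: phi_maximal.
exact: (@leq_bigmax_seq _ _ xpredT id _ phi_last).
Qed.

Lemma phi_Ck : Ck kappa.+1 #|` G|.+1 (phi kappa G).
Proof.
have [a_bnd gap_a _] := alphaP; have [cardE _] := phi_ell.
split=> // [x xphi|].
  apply/andP; split.
    by case/phi_in: xphi => [->|[i _ ->]]; lia.
  (* The bound l_g <= 2g - 1 gives l_g + 2 <= 2(g + 1) - 1. *)
  have := phi_maximal _ xphi.
  have /(gapset_leq G _ gapG) : ell G #|` G| \in G by apply: ell_in; lia.
  lia.
rewrite /max_distance; case: eqP => [phi1|_].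
  by move: cardE; rewrite phi1 cardfs1; lia.
rewrite cardE; apply/eqP; rewrite eqn_leq; apply/andP; split.
  apply/bigmax_leqP_seq => -[|[|i]]; rewrite mem_index_iota // => i_bnd _.
    by rewrite phi_gap1.
  rewrite phi_gapS; last by lia.
  by have := gap_le i.+1; lia.
(* The maximum is attained at alpha + 1, where the gap kappa has been widened. *)
have -> : kappa.+1 = gap (phi kappa G) a.+1 by rewrite phi_gapS //; lia.
by apply: leq_bigmax_seq => //; rewrite mem_index_iota; lia.
Qed.

(** * Multiples of m + 1 in the image, and the depth 1 case *)

Let m := multiplicity G.

(** Otherwise l_alpha + 1 <= m - 1 lies in G, which forces kappa = 1; but m - 1 is not the last
    element and the next one skips m, a gap of at least 2. *)
Lemma ell_alpha_ge : m < ell G #|` G| -> m.-1 <= ell G a.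
Proof.
move=> lt_m; have [_ mG ltG] := multiplicityP G; rewrite -/m in mG ltG.
have m_gt1 : 1 < m by apply: gapset_multiplicity_gt1 => //; lia.
have [a_bnd gap_a _] := alphaP.
rewrite leqNgt; apply/negP => lt_a.
have /in_ell[j j_bnd m1E] : m.-1 \in G by apply: ltG; lia.
have j_lt : j < #|` G|.
  rewrite ltn_neqAle; case/andP: j_bnd => _ ->; rewrite andbT.
  by apply/eqP => jE; move: m1E; rewrite jE; lia.
have := gap_le j; have := @ltn_ell G j j.+1; rewrite /gap -m1E.
have ellj_m : ell G j.+1 != m by apply: contraNneq mG => <-; apply: ell_in; lia.
have aSG : (ell G a).+1 \in G by apply: ltG; lia.
have := ellS_le G a _ aSG; move: gap_a; rewrite /gap; lia.
Qed.

(** The bounds on l_g cover depths 2 and 3 together, as l_g is never a multiple of m. The only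
    multiple of m + 1 that can then appear is 2m + 2, and it appears exactly in the excluded
    case. *)
Lemma phi_mset : m < ell G #|` G| < 3 * m ->
  is_mset m.+1 (phi kappa G) <->
  ~ (2 * m + 1 \in G /\ 2 * m + 1 <= ell G a).
Proof.
move=> /andP[lt_m lt_3m]; have [_ mG ltG] := multiplicityP G.
rewrite -/m in mG ltG; have [a_bnd _ _] := alphaP.
have m_gt1 : 1 < m by apply: gapset_multiplicity_gt1 => //; lia.
have a_ge := ell_alpha_ge lt_m.
(* This trades the condition on indices in [phi_in] for one on values, comparable with m. *)
have le_alpha i : 0 < i <= #|` G| -> (ell G i <= ell G a) = (i <= a).
  by move=> i_bnd; have := @ltn_ell G a i; have := @leq_ell G i a; lia.
split=> [[_ _ _ no_mul] [mem2m le2m]|no2m].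
  have /no_mul/negP[] : 2 * m + 2 \in phi kappa G.
    apply/phi_in; right; case/in_ell: mem2m => i i_bnd iE.
    by exists i => //; have := le_alpha i i_bnd; lia.
  by rewrite (_ : 2 * m + 2 = 2 * m.+1) ?dvdn_mull //; lia.
split; first by lia.
- by apply/negP => /phi_in[//|[i _]]; lia.
(* For 2 <= x <= m, the element x - 1 is at most m - 1 <= l_alpha, so it is shifted by 1 only. *)
- move=> x x_bnd; apply/phi_in; have [->|x1] := eqVneq x 1; first by left.
  have /in_ell[i i_bnd xE] : x.-1 \in G by apply: ltG; lia.
  by right; exists i => //; have := le_alpha i; lia.
move=> x xphi; apply/negP => /dvdnP[k xE]; rewrite {x}xE in xphi *.
(* The largest element is l_g + 2 <= 3m + 1 < 3(m + 1). *)
have k_lt3 : k < 3.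
  have : k * m.+1 < 3 * m.+1 by have := phi_maximal _ xphi; lia.
  by rewrite ltn_pmul2r.
case/phi_in: xphi => [/eqP|[i i_bnd xi]]; first by rewrite muln_eq1; lia.
have ellG := ell_in G i i_bnd.
have le_i := le_alpha i i_bnd.
have [k0|[k1|k2]] : k = 0 \/ k = 1 \/ k = 2 by lia.
- by subst k; lia.
(* If alpha < i then l_i = m - 1 <= l_alpha, a contradiction; otherwise l_i = m, which is not in
   G. *)
- subst k; case: (ltnP a i) xi le_i => /= ai xi le_i; first by lia.
  have ellm : ell G i = m by lia.
  by rewrite ellm (negbTE mG) in ellG.
(* The preimage is 2m, a multiple of m, if alpha < i, and 2m + 1 otherwise. *)
- subst k; case: (ltnP a i) xi le_i => /= ai xi le_i.
    have ellm : ell G i = 2 * m by lia.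
    by move: ellG; rewrite ellm; apply/negP/(gapset_dvd _ m); rewrite ?dvdn_mull.
  have ellm : ell G i = 2 * m + 1 by lia.
  by apply: no2m; rewrite -ellm; split=> //; lia.
Qed.

(** Here G = [1, m - 1], so all gaps are 1 and alpha = m - 2: only m - 1 is shifted by 2, and m is
    skipped. *)
Lemma phi_in_depth1 : ell G #|` G| < m ->
  forall x, x \in phi kappa G <-> (0 < x < m) || (x == m.+1).
Proof.
move=> lt_m x; have [_ mG ltG] := multiplicityP G; rewrite -/m in mG ltG.
have [a_bnd gap_a gap_lt] := alphaP; case: (gapG) => G0 _.
have [cardE ellE] : #|` G| = m.-1 /\ forall i, 0 < i <= m.-1 -> ell G i = i.
  apply: (ell_unique _ _ id) => // y; split=> [yG|[i i_bnd ->]]; last first.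
    by apply: ltG; lia.
  exists y => //; have y0 : y != 0 by apply: contraNneq G0 => <-.
  case/in_ell: (yG) => i i_bnd yE; have := @leq_ell G i #|` G|; lia.
have k1 : kappa = 1 by rewrite -gap_a /gap !ellE; lia.
have aE : a = #|` G|.-1.
  (* A gap after alpha would be smaller than kappa = 1, hence 0. *)
  have := gap_lt a.+1; rewrite /gap => gap_aS.
  have [//|ne_a] := eqVneq a #|` G|.-1.
  by have := @ltn_ell G a.+1 a.+2; lia.
rewrite phi_in; split=> [[->|[i i_bnd ->]]|].
- by lia.
- by rewrite ellE; lia.
- move=> x_bnd; have [->|x1] := eqVneq x 1; first by left.
  right; exists (if x == m.+1 then m.-1 else x.-1); first by case: eqP; lia.
  by case: eqP => xm; rewrite ellE; lia.
Qed.

End Phi.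

(** * Images in depth 1, and the genera 0 and 1 *)

(** If x + y = m + 1 and x is not in [1, m - 1], then x = m and y = 1. The conductor is m + 2, and m
    < m + 2 <= 2m. *)
Lemma interval_skip_gapset (A : {fset nat}) m : 1 < m ->
  (forall x, x \in A <-> (0 < x < m) || (x == m.+1)) ->
  is_gapset A /\ depth A = 2.
Proof.
move=> m_gt1 A_def; have mA : m \notin A by apply/negP => /A_def; lia.
split; first split.
- by apply/negP => /A_def; lia.
- move=> x y x_gt0 y_gt0 /A_def xy.
  case: (boolP (0 < x < m)) => x_bnd; [left|right]; apply/A_def; lia.
have mE : multiplicity A = m.
  apply: multiplicity_unique => //; first by lia.
  by move=> x x_bnd; apply/A_def; rewrite x_bnd.
have cE : conductor A = m.+2.
  by apply: conductor_max => [|y /A_def]; [apply/A_def|]; lia.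
by rewrite /depth mE cE; apply/ceil_div_eqS; lia.
Qed.

Lemma pure_sparse_ge2 kappa (G : {fset nat}) : 1 < #|` G| ->
  pure_sparse kappa G ->
  (forall i, 1 <= i < #|` G| -> gap G i <= kappa) /\
  (exists2 i, 1 <= i < #|` G| & gap G i = kappa).
Proof.
move=> G_ge2 [[G0 _]|[G1 _]|[_ gap_le gap_eq]] //.
  by move: G_ge2; rewrite G0 cardfs0.
by move: G_ge2; rewrite G1 cardfs1.
Qed.

Lemma phi_fset0 kappa : phi kappa fset0 = [fset 1]%fset.
Proof. by rewrite /phi eqxx. Qed.

Lemma phi_fset1 kappa : phi kappa [fset 1]%fset = [fset 1; 3]%fset.
Proof.
rewrite /phi; case: eqP => [/fsetP/(_ 1)|_]; last by rewrite eqxx.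
by rewrite !inE.
Qed.

Lemma ell_fset1_3 : #|` [fset 1; 3]%fset| = 2 /\
  forall i, 0 < i <= 2 -> ell [fset 1; 3]%fset i = 2 * i - 1.
Proof.
apply: (ell_unique _ _ (fun i => 2 * i - 1)) => [i j|x]; first by lia.
rewrite !inE; split=> [/orP[]/eqP->|[i i_bnd ->]]; [by exists 1|by exists 2|].
lia.
Qed.

(** The exception in depth 3 is exact: there 2m + 2 lies in the image, which is therefore not an (m
    + 1)-set. *)
Theorem theorem4p1 (g kappa : nat) :
  [/\ set_fun (Gk kappa g) (Ck kappa.+1 g.+1) (phi kappa),
      set_inj (Gk kappa g) (phi kappa)
    & forall (G : {fset nat}) (m : nat),
        Gk kappa g G -> multiplicity G = m ->
        [/\ depth G = 1 ->
              is_gapset (phi kappa G) /\ depth (phi kappa G) = 2,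
            depth G = 2 ->
              is_mset m.+1 (phi kappa G) /\ mset_depth m.+1 (phi kappa G) = 2
          & depth G = 3 ->
              (is_mset m.+1 (phi kappa G) /\ mset_depth m.+1 (phi kappa G) = 3)
              <-> ~ (2 * m + 1 \in G /\ 2 * m + 1 <= ell G (alpha kappa G))] ].
Proof.
split.
- move=> G [gapG gE ps]; rewrite -gE.
  have [G_lt2|G_ge2] := ltnP #|` G| 2; last first.
    have [gap_le gap_eq] := pure_sparse_ge2 _ _ G_ge2 ps.
    exact: phi_Ck.
  case: ps => [[-> ->]|[-> ->]|[]]; last by lia.
    rewrite phi_fset0 cardfs0; split; last by rewrite /max_distance eqxx.
      by move=> x /fset1P ->.
    by rewrite cardfs1.
  rewrite phi_fset1 cardfs1; have [cE eE] := ell_fset1_3; split=> //.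
    by move=> x; rewrite !inE => /orP[]/eqP->.
  rewrite /max_distance; case: eqP => [E|_].
    by move: cE; rewrite E cardfs1.
  by rewrite cE big_nat1 /gap !eE.
- move=> G H /set_mem[gapG gE psG] /set_mem[gapH hE psH] eq_phi.
  have [g_lt2|g_ge2] := ltnP g 2.
    (* Below genus 2, the value of kappa alone determines the set. *)
    case: psG => [[-> k0]|[-> k1]|[G_ge2 _ _]]; last by lia.
      by case: psH => [[-> _]|[_ k1]|[H_ge2 _ _]] //; lia.
    by case: psH => [[_ k0]|[-> _]|[H_ge2 _ _]] //; lia.
  have G_ge2 : 1 < #|` G| by lia.
  have H_ge2 : 1 < #|` H| by lia.
  have [gap_leG gap_eqG] := pure_sparse_ge2 _ _ G_ge2 psG.
  have [gap_leH gap_eqH] := pure_sparse_ge2 _ _ H_ge2 psH.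
  have [aG gap_aG _] := alphaP _ _ G_ge2 gap_leG gap_eqG.
  have [aH gap_aH _] := alphaP _ _ H_ge2 gap_leH gap_eqH.
  have gapSG := phi_gapS _ _ G_ge2 gapG gap_leG gap_eqG.
  have gapSH := phi_gapS _ _ H_ge2 gapH gap_leH gap_eqH.
  (* alpha is read off the image as the only place with a gap kappa + 1. *)
  have eq_a : alpha kappa G = alpha kappa H.
    have := gapSG _ aG; rewrite eq_phi gapSH; last by lia.
    by have := gap_leH (alpha kappa G); lia.
  apply: ell_inj => [|i i_bnd]; first by lia.
  (* With equal alphas, both enumerations of the image carry the same shift, which cancels. *)
  have := phi_ellS _ _ G_ge2 gapG gap_leG gap_eqG i i_bnd.
  rewrite eq_phi phi_ellS // ?eq_a; lia.
- move=> G m [gapG gE ps] mE.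
  have [m_gt0 mG ltG] := multiplicityP G; rewrite mE in m_gt0 mG ltG.
  have [G_lt2|G_ge2] := ltnP #|` G| 2.
    case: ps => [[G0 _]|[G1 _]|[]]; last by lia.
      (* The empty gapset has depth 0, so all three clauses are vacuous. *)
      have c0 : conductor G = 0.
        rewrite /conductor; case: ex_minnP => c _ c_min.
        have : c <= 0 by apply: c_min; apply/asboolP => n; rewrite G0 inE.
        by lia.
      have d0 : depth G = 0.
        by rewrite /depth mE c0 /ceil_div add0n divn_small //; lia.
      by rewrite d0.
    have m2 : m = 2.
      by rewrite -mE G1; apply: multiplicity_unique => // [|x x_bnd]; rewrite !inE; lia.
    have c2 : conductor G = 2.
      by rewrite G1; apply: conductor_max => [|y]; rewrite !inE // => /eqP->.
    have d1 : depth G = 1 by rewrite /depth mE c2 m2.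
    (* The set {1, 3} is the interval [1, 1] with 2 skipped. *)
    rewrite d1; split=> // _; apply: (interval_skip_gapset _ 2) => // x.
    by rewrite G1 phi_fset1 !inE; case: x => [|[|[|[|x]]]].
  have [gap_le gap_eq] := pure_sparse_ge2 _ _ G_ge2 ps.
  have G_gt0 : 0 < #|` G| by lia.
  have cE := conductor_ell G G_gt0.
  have m_gt1 := gapset_multiplicity_gt1 G gapG G_gt0; rewrite mE in m_gt1.
  have lastG : ell G #|` G| \in G by apply: ell_in; lia.
  (* As l_g is not a multiple of m, the bounds that the depth puts on l_g become strict. *)
  have last_dvd k : ell G #|` G| != k * m.
    apply: contraTneq lastG => ->.
    by apply: (gapset_dvd _ m) => //; rewrite dvdn_mull.
  have := phi_mset _ _ G_ge2 gapG gap_le gap_eq; rewrite mE => msetP.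
  rewrite /depth /mset_depth cE mE phi_bigmax //; split.
  + move/ceil_div_eqS => /(_ m_gt0) c_bnd.
    apply: (interval_skip_gapset _ m) => // x.
    by rewrite -mE; apply: phi_in_depth1 => //; lia.
  + move/ceil_div_eqS => /(_ m_gt0) c_bnd; have := last_dvd 1 => ne1.
    split; last by apply/ceil_div_eqS; lia.
    apply/msetP; first by lia.
    (* In depth 2, l_g < 2m, so 2m + 1 cannot be in G. *)
    move=> [mem2m _]; case/in_ell: mem2m => i i_bnd.
    by have := @leq_ell G i #|` G|; lia.
  + move/ceil_div_eqS => /(_ m_gt0) c_bnd; have := last_dvd 2 => ne2.
    rewrite -msetP; last by lia.
    (* The depth of the image is 3 in any case, since 2m < l_g < 3m and its maximum is l_g + 2. *)
    split=> [[]//|ms]; split=> //; apply/ceil_div_eqS; lia.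
Qed.
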